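(* Let $(V,\|\cdot\|)$ be a Minkowski plane. The following statements are equivalent: (1) the Minkowski plane is Radon; (2) there is a fixed $\gamma>0$ such that for any convex polygon $P$ circumscribed about a circle of radius $\rho$, $\rho\operatorname{per}(P)=\gamma\operatorname{area}(P)$; (3) there are a fixed $\gamma>0$ and a fixed $n\ge 3$ such that for any convex $n$-gon $P$ circumscribed about a circle of radius $\rho$, $\rho\operatorname{per}(P)=\gamma\operatorname{area}(P)$; (4) there is a fixed $\gamma>0$ such that for any triangle $P$ circumscribed about a circle of radius $\rho$, $\rho\operatorname{per}(P)=\gamma\operatorname{area}(P)$. (Here $\rho>0$ is arbitrary.)
   Context: A Minkowski plane is a two-dimensional real vector space $V$ equipped with a norm $\|\cdot\|$; $V$ also carries a fixed area measure (a translation-invariant Lebesgue measure, unique up to a positive factor), denoted $\operatorname{area}$. A circle of radius $\rho$ is the boundary of a ball $\{z:\|z-c\|\le\rho\}$. A convex polygon $P$ is circumscribed about a circle if it contains the ball bounded by the circle and each line containing a side of $P$ supports that ball. $\operatorname{per}(P)$ is the sum of the lengths of the sides of $P$ measured in the norm $\|\cdot\|$. For non-zero $x,y\in V$, $x$ is normal to $y$, written $x\dashv y$, if $\|x\|\le\|x+\lambda y\|$ for all $\lambda\in\mathbb{R}$. The plane is called Radon if normality is symmetric: $x\dashv y\iff y\dashv x$ for all non-zero $x,y\in V$.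
   Formalization: A convex n-gon may have straight angles at some of its n vertices; if all angles had to be less than π, (3) would hold vacuously with n = 9 for the non-Radon plane whose unit ball is a parallelogram, and the equivalence would fail. *)

(* Defs.v *)
From HB Require Import structures.
From mathcomp Require Import all_boot all_order all_algebra.
From mathcomp Require Import all_classical all_reals all_analysis.
Set Implicit Arguments.
Unset Strict Implicit.
Unset Printing Implicit Defensive.
Import Order.TTheory GRing.Theory Num.Theory.
Import numFieldNormedType.Exports.
Local Open Scope classical_set_scope.
Local Open Scope ring_scope.

Definition normal_to (R : realType) (V : normedModType R) (x y : V) : Prop :=
  forall l : R, `|x| <= `|x + l *: y|.

Definition radon (R : realType) (V : normedModType R) : Prop :=
  forall x y : V, x != 0 -> y != 0 -> (normal_to x y <-> normal_to y x).

Definition lin_comb2 (R : realType) (V : normedModType R) (e1 e2 : V)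
    (p : R * R) : V :=
  p.1 *: e1 + p.2 *: e2.

Definition is_basis2 (R : realType) (V : normedModType R) (e1 e2 : V) : Prop :=
  bijective (lin_comb2 e1 e2).

(* Lebesgue measure on V, normalized so that the parallelogram spanned by the
   basis (e1, e2) has area 1. Every positive multiple of it is of the same form
   for a rescaled basis, so that letting (e1, e2) range over all bases gives
   all the choices of the area measure. *)
Definition area (R : realType) (V : normedModType R) (e1 e2 : V)
    (A : set V) : \bar R :=
  (@lebesgue_measure R \x @lebesgue_measure R)%E (lin_comb2 e1 e2 @^-1` A).

Definition line (R : realType) (V : normedModType R) (p q : V) : set V :=
  [set p + t *: (q - p) | t in [set: R]].

Definition half_open_segment (R : realType) (V : normedModType R)
    (p q : V) : set V :=
  [set p + t *: (q - p) | t in `[0, 1[].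

(* For p != q in a plane, a non-zero linear form f with f p = f q has the line
   through p and q as a level set. *)
Definition on_one_side (R : realType) (V : normedModType R) (p q : V)
    (A : set V) : Prop :=
  exists f : {scalar V},
    [/\ exists x, f x != 0, f p = f q & forall x, A x -> f x <= f p].

Definition line_supports (R : realType) (V : normedModType R) (p q : V)
    (A : set V) : Prop :=
  line p q `&` A !=set0 /\ on_one_side p q A.

(* A polygon is given by its vertices v 0, ..., v (n - 1) in cyclic order (in
   either orientation); ordS is the cyclic successor, so the sides are the
   segments from v i to v (ordS i). The polygon is convex if it is simple and
   lies in a closed half-plane bounded by each of its side lines. Interior
   angles are thus at most pi, and a straight angle at a vertex is allowed.
   Disjointness of the half-open sides expresses that the closed polygonal line
   is simple; in particular the vertices are distinct. *)
Definition convex_polygon (R : realType) (V : normedModType R) (n : nat)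
    (v : 'I_n -> V) : Prop :=
  [/\ (3 <= n)%N,
      trivIset [set: 'I_n] (fun i => half_open_segment (v i) (v (ordS i)))
    & forall i, on_one_side (v i) (v (ordS i)) (range v)].

(* The region bounded by a convex polygon: the convex hull of its vertices. *)
Definition region (R : realType) (V : normedModType R) (n : nat)
    (v : 'I_n -> V) : set V :=
  smallest (fun A : set V => @convex_set R V A) (range v).

Definition per (R : realType) (V : normedModType R) (n : nat)
    (v : 'I_n -> V) : R :=
  \sum_(i < n) `|v (ordS i) - v i|.

Definition circumscribed (R : realType) (V : normedModType R) (n : nat)
    (v : 'I_n -> V) (c : V) (rho : R) : Prop :=
  closed_ball_ Num.norm c rho `<=` region v /\
  forall i, line_supports (v i) (v (ordS i)) (closed_ball_ Num.norm c rho).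

(* Main.v *)
Require Import Defs.
From HB Require Import structures.
From mathcomp Require Import all_boot all_order all_algebra.
From mathcomp Require Import all_classical all_reals all_analysis.
From mathcomp Require Import measurable_realfun zify ring lra.
Set Implicit Arguments.
Unset Strict Implicit.
Unset Printing Implicit Defensive.
Import Order.TTheory GRing.Theory Num.Theory.
Import numFieldNormedType.Exports.
Local Open Scope classical_set_scope.
Local Open Scope ring_scope.

(** Let w be the oriented area form of the basis (e1, e2) and let h be the norm
    dual to the given one when w identifies the plane with its dual, that is,
    h y is the maximum of w x y over the unit ball.

    Normality says that a line supports a ball: x is normal to y exactly when
    |w x y| = h y |x| (normal_toE). If h is a multiple of the norm, both
    sides are symmetric in x and y and the plane is Radon.
    Conversely (radon_dual_norm), in a Radon plane the norm and h, restricted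
    to a line missing 0, are convex functions having proportional subgradients
    at each point: a unit vector x with w x z = h z is normal to z, so z is
    normal to x, so w x is a subgradient of h at z and a multiple of it is one
    of the norm. Hence the ratio of the two functions has increments bounded
    by products of increments of the parameter and of the subgradient, and
    summing over finer and finer partitions shows that it is constant.

    A polygon circumscribed about the ball of centre c and radius rho is cut by
    the segments from c to its vertices into triangles whose bases are the
    sides. As the side lines support the ball, the triangle over a side s has
    area rho h(s) / 2, so the polygon has area rho / 2 times the sum of the
    h(s) (area_region). If h = k |.|, this is rho per(P) k / 2 and gamma = 2/k.

    For the way back, given that rho per = gamma area for circumscribed
    n-gons, an n-gon with straight angles is obtained from a triangle by
    subdividing one of its sides, so the same holds for triangles. Any a, b
    with w a b > 0 are two sides of a circumscribed triangle, whose third side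
    is a + b up to sign. So the difference G of the norm and (gamma / 2) h
    satisfies G(a) + G(b) + G(a + b) = 0 for independent a and b, and the
    parallelogram on a and b then yields G = 0 (dual_norm_of_triangles). *)

(** * The area form of the plane *)

Definition coords (R : realType) (V : normedModType R) (e1 e2 x : V) : R * R :=
  xget (0, 0) [set p | lin_comb2 e1 e2 p = x].

(** The oriented area of the parallelogram on [x] and [y], in the unit of
    [area e1 e2]. *)
Definition det (R : realType) (V : normedModType R) (e1 e2 x y : V) : R :=
  (coords e1 e2 x).1 * (coords e1 e2 y).2 -
  (coords e1 e2 x).2 * (coords e1 e2 y).1.

Section AreaForm.
Variables (R : realType) (V : normedModType R) (e1 e2 : V).
Hypothesis he : is_basis2 e1 e2.
Local Notation "''w'" := (det e1 e2).

Lemma lin_comb2K : cancel (lin_comb2 e1 e2) (coords e1 e2).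
Proof.
move=> p; rewrite /coords; case: xgetP => [q _ /=|/(_ p) /=]; last by [].
exact: (bij_inj he).
Qed.

Lemma coordsK : cancel (coords e1 e2) (lin_comb2 e1 e2).
Proof.
move=> x; have [g _ gK] := he.
by rewrite -{1}[x]gK lin_comb2K gK.
Qed.

Lemma coordsD x y : coords e1 e2 (x + y) = coords e1 e2 x + coords e1 e2 y.
Proof.
apply: (can_inj lin_comb2K).
rewrite coordsK -{1}[x]coordsK -{1}[y]coordsK /lin_comb2 /= !scalerDl.
by rewrite addrACA.
Qed.

Lemma coordsZ l x :
  coords e1 e2 (l *: x) = (l * (coords e1 e2 x).1, l * (coords e1 e2 x).2).
Proof.
apply: (can_inj lin_comb2K).
by rewrite coordsK -{1}[x]coordsK /lin_comb2 /= scalerDr !scalerA.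
Qed.

Lemma detDl x y z : 'w (x + y) z = 'w x z + 'w y z.
Proof. rewrite /det coordsD /=; ring. Qed.
Lemma detDr x y z : 'w z (x + y) = 'w z x + 'w z y.
Proof. rewrite /det coordsD /=; ring. Qed.
Lemma detZl l x z : 'w (l *: x) z = l * 'w x z.
Proof. rewrite /det coordsZ /=; ring. Qed.
Lemma detZr l x z : 'w z (l *: x) = l * 'w z x.
Proof. rewrite /det coordsZ /=; ring. Qed.
Lemma detNl x z : 'w (- x) z = - 'w x z.
Proof. by rewrite -scaleN1r detZl mulN1r. Qed.
Lemma detNr x z : 'w z (- x) = - 'w z x.
Proof. by rewrite -scaleN1r detZr mulN1r. Qed.
Lemma detBl x y z : 'w (x - y) z = 'w x z - 'w y z.
Proof. by rewrite detDl detNl. Qed.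
Lemma detBr x y z : 'w z (x - y) = 'w z x - 'w z y.
Proof. by rewrite detDr detNr. Qed.
Lemma detxx x : 'w x x = 0.
Proof. rewrite /det; ring. Qed.
Lemma detC x y : 'w y x = - 'w x y.
Proof. rewrite /det; ring. Qed.
Lemma det0l x : 'w 0 x = 0.
Proof. by rewrite -(scale0r 0) detZl mul0r. Qed.
Lemma det0r x : 'w x 0 = 0.
Proof. by rewrite detC det0l oppr0. Qed.
Definition det_lin := (detDl, detDr, detNl, detNr, detZl, detZr, detxx).

Lemma det_linear_form x : exists f : {scalar V}, forall y, f y = 'w x y.
Proof.
have lin : linear_for *%R ('w x) by move=> l y z; rewrite detDr detZr.
pose f : {scalar V} :=
  HB.pack ('w x) (GRing.isLinear.Build R V R *%R ('w x) lin).
by exists f.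
Qed.

(** Any three vectors of a plane are dependent, the coefficients being the
    2 x 2 minors of their coordinates. *)
Lemma cramer a b x : 'w a b *: x = 'w x b *: a + 'w a x *: b.
Proof.
apply: (can_inj coordsK); rewrite coordsD !coordsZ /det.
by congr pair => /=; ring.
Qed.

Lemma cramer_scalar (f : {scalar V}) a b x :
  'w a b * f x = 'w x b * f a + 'w a x * f b.
Proof. by have := congr1 f (cramer a b x); rewrite linearD !linearZ. Qed.

Lemma cramer_div a b x : 'w a b != 0 ->
  x = ('w x b / 'w a b) *: a + ('w a x / 'w a b) *: b.
Proof.
move=> ab0; apply: (scalerI ab0); rewrite cramer scalerDr !scalerA.
by rewrite ![_ * (_ / _)]mulrC !divfK.
Qed.

Lemma det_basis : 'w e1 e2 = 1.
Proof.
have c1 : coords e1 e2 e1 = (1, 0).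
  by rewrite -[RHS]lin_comb2K /lin_comb2 /= scale1r scale0r addr0.
have c2 : coords e1 e2 e2 = (0, 1).
  by rewrite -[RHS]lin_comb2K /lin_comb2 /= scale1r scale0r add0r.
by rewrite /det c1 c2 /= mulr1 mulr0 subr0.
Qed.

Lemma det_nondeg y : y != 0 -> exists x, 'w x y != 0.
Proof.
move=> y0; apply: contrapT => /forallNP h; case/eqP: y0.
have w0 x : 'w x y = 0 by move: (h x) => /negP; rewrite negbK => /eqP.
rewrite -[y]scale1r -det_basis cramer [X in X *: e1]detC !w0.
by rewrite oppr0 !scale0r addr0.
Qed.

Lemma det0_parallel x y : y != 0 -> 'w x y = 0 -> exists l, x = l *: y.
Proof.
move=> y0 xy; have [z zy] := det_nondeg y0.
exists ('w z x / 'w z y).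
by rewrite {1}(cramer_div x zy) xy mul0r scale0r add0r.
Qed.

Lemma basis_neq0 : e1 != 0.
Proof.
by apply/eqP => e10; move/eqP: det_basis; rewrite {2}e10 det0l eq_sym oner_eq0.
Qed.

(** * Normality and the dual norm *)

(** A point nearest to 0 on a line of direction [y] that misses 0 is normal to
    [y]; it exists because the points [a + t *: y] with [|t| > T] are longer than
    [a], so that the minimum is over a segment. *)
Lemma exists_normal (y : V) : y != 0 ->
  exists x, [/\ `|x| = 1, 0 < 'w x y & normal_to x y].
Proof.
move=> y0; have [a ay] := det_nondeg y0.
pose T := 2 * `|a| / `|y|.
have T0 : 0 <= T by rewrite divr_ge0 ?mulr_ge0.
have ny0 : 0 < `|y| by rewrite normr_gt0.
have [||c _ cmin] := @EVT_min R (fun t => `|a + t *: y|) (- T) T.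
- by rewrite (le_trans _ T0)// oppr_le0.
- apply: continuous_subspaceT => t.
  apply: (@cvg_norm _ V).
  apply: cvgD; first exact: cvg_cst.
  exact: (cvgZr_tmp cvg_id).
have cglob t : `|a + c *: y| <= `|a + t *: y|.
  have [tT|Tt] := leP `|t| T; first by apply: cmin; rewrite in_itv/= -ler_norml.
  apply: (@le_trans _ _ `|a|).
    by rewrite -[X in _ <= `|X|]addr0 -(scale0r y) cmin// in_itv/= oppr_le0 T0.
  have : 2 * `|a| < `|t *: y| by rewrite normrZ -ltr_pdivrMr.
  have := lerB_normD (t *: y) a; rewrite [t *: y + a]addrC; lra.
pose x := a + c *: y.
have wx : 'w x y = 'w a y by rewrite /x !det_lin mulr0 addr0.
have x0 : 0 < `|x|.
  rewrite normr_gt0; apply: contraNneq ay => x0.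
  by rewrite -wx x0 det0l.
have xn l : `|x| <= `|x + l *: y| by rewrite /x -addrA -scalerDl.
(* [k] normalizes [x] and turns it to the positive side of the line of [y]. *)
pose k := Num.sg ('w a y) / `|x|.
have nk : `|k| = `|x|^-1.
  by rewrite normrM normr_sg ay mul1r ger0_norm// invr_ge0 ltW.
have k0 : k != 0 by rewrite -normr_eq0 nk invr_eq0 gt_eqF.
exists (k *: x); split.
- by rewrite normrZ nk mulVf// gt_eqF.
- by rewrite detZl wx mulrAC -normrEsg divr_gt0// normr_gt0.
- move=> l; rewrite -[l](mulVKf k0) -(scalerA k) -scalerDr !normrZ.
  by rewrite ler_wpM2l.
Qed.

(** The norm dual to the given one when [x |-> det x y] identifies the plane with
    its dual. *)
Definition dual_norm y : R := sup [set 'w x y | x in [set x | `|x| <= 1]].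

(** The supremum is attained at a unit vector [x] normal to [y]: writing [u] as
    [(w u y / w x y) *: x] plus a multiple of [y], normality of [x] bounds the
    coefficient of [x] by the norm of [u]. *)
Lemma dual_norm_spec y : exists x,
  [/\ `|x| = 1, 'w x y = dual_norm y
    & forall u, `|'w u y| <= dual_norm y * `|u|].
Proof.
suff [x [x1 xw xmax]] : exists x,
    [/\ `|x| = 1, 0 <= 'w x y & forall u, `|'w u y| <= 'w x y * `|u|].
  have hE : 'w x y = dual_norm y.
    apply/eqP; rewrite eq_le; apply/andP; split.
      apply: ub_le_sup; last by exists x => //=; rewrite x1.
      exists ('w x y) => _ [u /= u1 <-].
      by rewrite (le_trans (ler_norm _))// (le_trans (xmax u))// ler_piMr.
    apply: ge_sup; first by exists ('w x y), x => //=; rewrite x1.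
    move=> _ [u /= u1 <-].
    by rewrite (le_trans (ler_norm _))// (le_trans (xmax u))// ler_piMr.
  by exists x; split => // u; rewrite -hE.
have [->|y0] := eqVneq y 0.
  exists (`|e1|^-1 *: e1); split.
  - by rewrite normrZ normfV normr_id mulVf// normr_eq0 basis_neq0.
  - by rewrite det0r.
  - by move=> u; rewrite !det0r normr0 mul0r.
have [x [x1 xw xn]] := exists_normal y0.
exists x; split => //; first exact: ltW.
move=> u; have xw0 : 'w x y != 0 by rewrite gt_eqF.
have [uy|uy] := eqVneq ('w u y) 0; first by rewrite uy normr0 mulr_ge0// ltW.
have {2}-> := cramer_div u xw0.
have a0 : 'w u y / 'w x y != 0 by rewrite mulf_neq0// invr_eq0.
set b := 'w x u / _.
rewrite -[b](mulVKf a0) -(scalerA ('w u y / 'w x y)) -scalerDr normrZ.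
have -> : forall z, 'w x y * (`|'w u y / 'w x y| * z) = `|'w u y| * z.
  move=> z; rewrite normrM normfV (gtr0_norm xw) mulrA [_ * (_ / _)]mulrC.
  by rewrite divfK.
by rewrite ler_peMr// -x1 xn.
Qed.

Lemma dual_norm_attained y : exists2 x, `|x| = 1 & 'w x y = dual_norm y.
Proof. by have [x [? ? _]] := dual_norm_spec y; exists x. Qed.

Lemma det_le x y : `|'w x y| <= dual_norm y * `|x|.
Proof. by have [? [_ _]] := dual_norm_spec y; apply. Qed.

Lemma dual_norm_ge0 y : 0 <= dual_norm y.
Proof.
have [x x1 _] := dual_norm_attained y.
by have := det_le x y; rewrite x1 mulr1; exact: le_trans.
Qed.

Lemma dual_norm_gt0 y : y != 0 -> 0 < dual_norm y.
Proof.
move=> y0; have [x xy] := det_nondeg y0.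
have : 0 < `|'w x y| by rewrite normr_gt0.
move=> /lt_le_trans/(_ (det_le x y)).
by apply: contraTT; rewrite -!leNgt => h; rewrite mulr_le0_ge0.
Qed.

Lemma dual_normZ l y : dual_norm (l *: y) = `|l| * dual_norm y.
Proof.
apply/eqP; rewrite eq_le; apply/andP; split.
  have [x x1 <-] := dual_norm_attained (l *: y).
  rewrite (le_trans (ler_norm _))// detZr normrM ler_wpM2l//.
  by rewrite (le_trans (det_le _ _))// x1 mulr1.
have [x x1 <-] := dual_norm_attained y.
rewrite -[leRHS]mulr1 -x1 (le_trans _ (det_le _ _))// detZr normrM.
by rewrite ler_wpM2l// ler_norm.
Qed.

Lemma dual_norm0 : dual_norm 0 = 0.
Proof. by rewrite -[X in dual_norm X](scale0r 0) dual_normZ normr0 mul0r. Qed.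

(** The form [u |-> det u y] is constant on the line through [x] of direction
    [y] and is bounded by [dual_norm y] times the norm, so equality at [x] makes
    [x] shortest on that line. Conversely, a shortest point cannot lose against
    the multiple, lying on the same line, of a vector that attains
    [dual_norm y]. *)
Lemma normal_toE x y : normal_to x y <-> `|'w x y| = dual_norm y * `|x|.
Proof.
have [->|y0] := eqVneq y 0.
  split => [_|_ l]; last by rewrite scaler0 addr0.
  by rewrite dual_norm0 det0r normr0 mul0r.
split => [xn|xy l].
  apply/eqP; rewrite eq_le det_le /=.
  have [wxy|wxy] := eqVneq ('w x y) 0.
    have [l xl] := det0_parallel y0 wxy.
    have := xn (- l); rewrite {2}xl scaleNr subrr normr0 normr_le0 => /eqP ->.
    by rewrite normr0 mulr0.
  have [u u1 uy] := dual_norm_attained y.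
  have uE := cramer_div u wxy.
  have a0 : 'w u y / 'w x y != 0.
    by rewrite mulf_neq0// ?invr_eq0// uy gt_eqF// dual_norm_gt0.
  move: uE; set b := 'w x u / _.
  rewrite -[b](mulVKf a0) -(scalerA ('w u y / 'w x y)) -scalerDr.
  move=> /(congr1 Num.norm); rewrite u1 normrZ => E.
  have := xn (('w u y / 'w x y)^-1 * b).
  rewrite -(@ler_pM2l _ `|'w u y / 'w x y|) ?normr_gt0// -E.
  rewrite normrM normfV uy (gtr0_norm (dual_norm_gt0 y0)) mulrAC.
  by rewrite ler_pdivrMr ?normr_gt0// mul1r.
rewrite -(@ler_pM2l _ (dual_norm y)) ?dual_norm_gt0//.
rewrite -xy (le_trans _ (det_le _ _))//.
by rewrite !det_lin mulr0 addr0.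
Qed.

End AreaForm.

(** * Radon planes are those whose dual norm is proportional to the norm *)

(** Over a partition of an interval into equal steps the bounds telescope in [g]
    and keep one step as a factor, hence tend to 0 as the partition is refined. *)
Lemma eq_of_monotone_modulus (R : realType) (f g : R -> R) :
  (forall s t, f s - f t <= (s - t) * (g s - g t)) -> forall s t, f s = f t.
Proof.
move=> fg a b.
have key (k : nat) : `|f b - f a| <= (b - a) * (g b - g a) / k.+1%:R.
  pose p i : R := a + (b - a) * (i%:R / k.+1%:R).
  have pS i : p i.+1 - p i = (b - a) / k.+1%:R.
    by rewrite /p -[i.+1%:R]natr1; ring.
  have p0 : p 0%N = a by rewrite /p mul0r mulr0 addr0.
  have pk : p k.+1 = b by rewrite /p divff ?pnatr_eq0// mulr1 addrC subrK.
  rewrite -{1}p0 -{1}pk -(telescope_sumr (f \o p))//=.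
  rewrite (le_trans (ler_norm_sum _ _ _))//.
  have -> : (b - a) * (g b - g a) / k.+1%:R =
      \sum_(0 <= i < k.+1) (b - a) / k.+1%:R * (g (p i.+1) - g (p i)).
    by rewrite -mulr_sumr (telescope_sumr (g \o p))//=  p0 pk mulrAC.
  apply: ler_sum => i _; rewrite -(pS i) ler_norml fg andbT lerNl opprB.
  by rewrite (le_trans (fg _ _))// -mulrNN !opprB.
apply/eqP; rewrite eq_sym -subr_eq0 -normr_le0; apply/ler_addgt0Pl => e e0.
rewrite addr0; set C := (b - a) * (g b - g a) in key.
have C0 : 0 <= C by have := le_trans (normr_ge0 _) (key 0); rewrite divr1.
have := truncnS_gt (C / e); set k := Num.truncn _ => Ck.
rewrite (le_trans (key k))// ler_pdivrMr// mulrC -ler_pdivrMr//.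
exact: ltW.
Qed.

Section RadonDual.
Variables (R : realType) (V : normedModType R) (e1 e2 : V).
Hypothesis he : is_basis2 e1 e2.
Local Notation "''w'" := (det e1 e2).
Local Notation h := (dual_norm e1 e2).
Local Notation det_lin := (det_lin he).

Lemma radon_of_dual_norm (k : R) : (forall y, h y = k * `|y|) -> radon V.
Proof.
move=> hk x y _ _; rewrite !(normal_toE he) !hk (detC _ _ x y) normrN.
by rewrite mulrAC.
Qed.

(** On the line [z t = y + t *: u] let [f] be the ratio of the two norms, and
    [x t] a unit vector attaining [h (z t)]. Then [x t] is normal to [z t], hence
    [z t] is normal to [x t], which means [h (x t) = f t]. So
    [w (x t) (z s) = h (z t) + (s - t) * g t] is at most [h (z s)] and at most
    [f t * |z s|]: the slope [g t] serves [h] and, up to the factor [f t], the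
    norm. These two bounds, with [s] and [t] exchanged in the first, control
    the variation of [f] by that of [g]. *)
Lemma radon_dual_norm_line (y u : V) : radon V -> 'w y u != 0 ->
  h y / `|y| = h (y + u) / `|y + u|.
Proof.
move=> rV yu.
pose z t := y + t *: u.
have u0 : u != 0 by apply: contraNneq yu => ->; rewrite (det0r he).
have wz t : 'w (z t) u = 'w y u by rewrite /z !det_lin mulr0 addr0.
have z0 t : z t != 0.
  by apply: contraNneq yu => zt; rewrite -(wz t) zt (det0l he).
have nz t : 0 < `|z t| by rewrite normr_gt0.
(* [m] bounds the norm away from 0 on the line, by duality with [u]. *)
pose m := `|'w y u| / h u.
have m0 : 0 < m by rewrite divr_gt0 ?normr_gt0 ?(dual_norm_gt0 he).
have mz t : m <= `|z t|.
  by rewrite ler_pdivrMr ?(dual_norm_gt0 he)// mulrC -(wz t) (det_le he).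
have /choice[x xP] t : exists x, `|x| = 1 /\ 'w x (z t) = h (z t).
  by have [x x1 xz] := dual_norm_attained he (z t); exists x.
have x1 t : `|x t| = 1 by case: (xP t).
have xz t : 'w (x t) (z t) = h (z t) by case: (xP t).
pose f t := h (z t) / `|z t|.
pose g t := 'w (x t) u.
have hx t : h (x t) = f t.
  have x0 : x t != 0 by rewrite -normr_eq0 x1 oner_neq0.
  have /(normal_toE he) : normal_to (z t) (x t).
    apply/rV => //; apply/(normal_toE he).
    by rewrite xz x1 mulr1 gtr0_norm// (dual_norm_gt0 he).
  rewrite detC normrN xz gtr0_norm ?(dual_norm_gt0 he)// /f => ->.
  by rewrite mulfK// gt_eqF.
have sub s t : 'w (x t) (z s) = h (z t) + (s - t) * g t.
  rewrite -xz /g -(detZr he) -(detDr he) /z -addrA -scalerDl.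
  by rewrite [t + _]addrC subrK.
have hsub s t : h (z t) + (s - t) * g t <= h (z s).
  rewrite -sub (le_trans (ler_norm _))// (le_trans (det_le he _ _))//.
  by rewrite x1 mulr1.
have fsub s t : h (z t) + (s - t) * g t <= f t * `|z s|.
  by rewrite -sub -hx (le_trans (ler_norm _))// detC normrN (det_le he).
have fE s : f s * `|z s| = h (z s) by rewrite /f divfK// gt_eqF.
have fg s t : f s - f t <= (s - t) * (g s / m - g t / m).
  have D0 : 0 <= (s - t) * (g s - g t).
    by have := hsub s t; have := hsub t s; nra.
  have key : (f s - f t) * `|z s| <= (s - t) * (g s - g t).
    by rewrite mulrBl fE; have := fsub s t; have := hsub t s; nra.
  rewrite -mulrBl mulrA ler_pdivlMr//.
  have [fst|fst] := leP 0 (f s - f t).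
    by rewrite (le_trans _ key)// ler_wpM2l.
  by rewrite (le_trans _ D0)// mulr_le0_ge0// ltW.
have := eq_of_monotone_modulus fg 0 1.
by rewrite /f /z scale0r addr0 scale1r.
Qed.

(** Independent vectors are joined by a line that misses 0, and dependent ones
    are compared by homogeneity. *)
Lemma radon_dual_norm : radon V ->
  exists2 k : R, 0 < k & forall y, h y = k * `|y|.
Proof.
move=> rV; have e10 := basis_neq0 he.
exists (h e1 / `|e1|); first by rewrite divr_gt0 ?normr_gt0// (dual_norm_gt0 he).
move=> y; have [->|y0] := eqVneq y 0.
  by rewrite (dual_norm0 he) normr0 mulr0.
have [/(det0_parallel he e10)[l ->]|yw] := eqVneq ('w y e1) 0.
  by rewrite (dual_normZ he) normrZ mulrCA divfK// normr_eq0.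
have := @radon_dual_norm_line y (e1 - y) rV.
rewrite [y + _]addrC subrK => <-.
  by rewrite divfK// normr_eq0.
by rewrite !det_lin subr0.
Qed.

(** For [G = |.| - m * h], which is even, the triangles with sides [a], [y] and
    [a], [- y] give [G (a + y) = G (a - y) = - G a - G y]; the one with sides
    [a + y] and [a - y], whose third side is [2 *: a], then gives [G y = 0]. *)
Lemma dual_norm_of_triangles (m : R) :
  (forall a b, 0 < 'w a b ->
    `|a| + `|b| + `|a + b| = m * (h a + h b + h (a + b))) ->
  forall y, `|y| = m * h y.
Proof.
move=> H.
pose G y := `|y| - m * h y.
have GN y : G (- y) = G y.
  by rewrite /G normrN -[- y]scaleN1r (dual_normZ he) normrN1 mul1r.
have G0 a b : 'w a b != 0 -> G a + G b + G (a + b) = 0.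
  move=> ab; have [ab0|ab0] : 'w a b < 0 \/ 0 < 'w a b.
      by apply/orP; rewrite -neq_lt.
    have := H b a; rewrite detC oppr_gt0 => /(_ ab0).
    by rewrite /G [b + a]addrC; lra.
  by have := H a b ab0; rewrite /G; lra.
move=> y; apply/eqP; rewrite -subr_eq0 -/(G y); apply/eqP.
have [->|y0] := eqVneq y 0.
  by rewrite /G (dual_norm0 he) normr0 mulr0 subr0.
have [a ay] := det_nondeg he y0.
have Gp := G0 a y ay.
have Gm : G a + G y + G (a - y) = 0.
  by rewrite -(GN y) G0// (detNr he) oppr_eq0.
have G2 : G (a + y) + G (a - y) + G (2 *: a) = 0.
  have -> : 2 *: a = (a + y) + (a - y).
    by rewrite addrACA subrr addr0 scaler_nat mulr2n.
  apply: G0; rewrite !det_lin (detC _ _ a y).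
  by apply: contraNneq ay; lra.
have G2E : G (2 *: a) = 2 * G a.
  by rewrite /G normrZ (dual_normZ he) ger0_norm//; lra.
lra.
Qed.
End RadonDual.

(** * Affine maps and the Lebesgue measure of the plane *)

Section PlaneMeasure.
Variable R : realType.
Local Notation mu := (@lebesgue_measure R).
Local Notation mu2 := (mu \x mu)%E.
Local Notation T := (measurableTypeR R).

Lemma measurable_affine (k c : R) :
  measurable_fun setT ((fun x => k * x + c) : T -> T).
Proof. by apply: measurable_funD => //; exact: mulrl_measurable. Qed.

Lemma lebesgue_measure_affine_gt0 (k c : R) (A : set T) :
  0 < k -> measurable A ->
  mu ((fun x => k * x + c) @^-1` A) = ((k^-1)%:E * mu A)%E.
Proof.
move=> k0 mA.
pose f (x : T) : T := k * x + c.
have mf : measurable_fun setT f by exact: measurable_affine.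
suff -> : mu A = pushforward (mscale (NngNum (ltW k0)) mu) f A.
  by rewrite /pushforward /mscale /= muleA -EFinM mulVf ?gt_eqF// mul1e.
apply: lebesgue_measure_unique => // _ [[a b] _ <-] /=.
rewrite /pushforward /mscale /=.
have -> : f @^-1` `]a, b] = `](a - c) / k, (b - c) / k]%classic.
  apply/seteqP; split => x /=; rewrite !in_itv /= /f.
    by rewrite ltr_pdivrMr// ler_pdivlMr// ltrBlDr lerBrDr mulrC.
  by rewrite ltr_pdivrMr// ler_pdivlMr// ltrBlDr lerBrDr mulrC.
rewrite !lebesgue_measure_itv /= !lte_fin ltr_pM2r ?invr_gt0// ltrD2r.
case: ifPn => _; last by rewrite mule0.
by rewrite -!EFinD -EFinM; congr EFin; field; rewrite gt_eqF.
Qed.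

Lemma lebesgue_measure_affine (k c : R) (A : set T) :
  k != 0 -> measurable A ->
  mu ((fun x => k * x + c) @^-1` A) = ((`|k|^-1)%:E * mu A)%E.
Proof.
move=> k0 mA; have [k1|k1] : k < 0 \/ 0 < k by apply/orP; rewrite -neq_lt.
  rewrite ltr0_norm// -(@lebesgue_measure_affine_gt0 _ c) ?oppr_gt0//.
  have mkA : measurable ((fun x : T => (k * x + c : T)) @^-1` A).
    by rewrite -[X in measurable X]setTI; exact: measurable_affine.
  rewrite -(lebesgue_measureN mkA) /pushforward.
  by congr (mu _); apply/seteqP; split => x /=; rewrite mulNr mulrN.
by rewrite gtr0_norm// lebesgue_measure_affine_gt0.
Qed.

Lemma measurable_fiber_affine (k : R) (phi : T -> T) :
  measurable_fun setT phi ->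
  measurable_fun setT (fun p : T * T => (p.1, k * p.2 + phi p.1) : T * T).
Proof.
move=> mphi; apply: measurable_fun_pair => //.
apply: measurable_funD; last exact: measurableT_comp.
exact: measurable_funM.
Qed.

(** Each vertical section of the preimage is an affine preimage, with the same
    ratio [k], of a section of [A]. *)
Lemma mu2_fiber_affine (k : R) (phi : T -> T) (A : set (T * T)) :
  k != 0 -> measurable_fun setT phi -> measurable A ->
  mu2 ((fun p : T * T => (p.1, k * p.2 + phi p.1) : T * T) @^-1` A) =
  ((`|k|^-1)%:E * mu2 A)%E.
Proof.
move=> k0 mphi mA; rewrite /product_measure1.
rewrite -ge0_integralZl//; last exact: measurable_fun_xsection.
apply: eq_integral => x _ /=.
rewrite -(@lebesgue_measure_affine _ (phi x))//.
exact: measurable_xsection.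
Qed.

Definition swap2 (p : T * T) : T * T := (p.2, p.1).

Lemma measurable_swap2 : measurable_fun setT swap2.
Proof. exact: measurable_swap. Qed.

Lemma mu2_swap (A : set (T * T)) : measurable A ->
  mu2 (swap2 @^-1` A) = mu2 A.
Proof.
move=> mA.
rewrite -[LHS]/(pushforward mu2 swap2 A).
apply/esym/product_measure_unique => //; first exact: measurable_swap2.
move=> ? B C mB mC; transitivity (mu2 (C `*` B)).
  congr (mu2 _).
  by apply/seteqP; split => -[x y] /= [].
by rewrite product_measure1E// muleC.
Qed.

Definition affine2 (p q c r s d : R) (x : T * T) : T * T :=
  (p * x.1 + q * x.2 + c, r * x.1 + s * x.2 + d).

Lemma measurable_affine2 p q c r s d :
  measurable_fun setT (affine2 p q c r s d).
Proof.
apply: measurable_fun_pair => /=.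
  apply: measurable_funD => //; apply: measurable_funD => //;
  exact: measurable_funM.
apply: measurable_funD => //; apply: measurable_funD => //;
exact: measurable_funM.
Qed.

(** When [p != 0] the map is a composition of two maps that are affine on the
    fibers and of two exchanges of the coordinates (Gaussian elimination with
    pivot [p]); otherwise [q] becomes the pivot after one exchange. *)
Lemma mu2_affine2 p q c r s d (A : set (T * T)) :
  p * s - q * r != 0 -> measurable A ->
  mu2 (affine2 p q c r s d @^-1` A) = ((`|p * s - q * r|^-1)%:E * mu2 A)%E.
Proof.
move=> D0 mA.
wlog p0 : p q r s D0 / p != 0.
  move=> H; have [p0|] := eqVneq p 0; last exact: H.
  have q0 : q != 0 by apply: contraNneq D0 => ->; rewrite p0; apply/eqP; ring.
  have := H q p s r; rewrite -oppr_eq0 -normrN opprB => /(_ D0 q0) <-.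
  rewrite -mu2_swap; last first.
    by rewrite -[X in measurable X]setTI; exact: measurable_affine2.
  congr (mu2 _); apply/seteqP; split => x /=; rewrite /affine2 /=.
    by rewrite ![_ * x.1 + _]addrC.
  by rewrite ![_ * x.2 + _]addrC.
pose D := s - r / p * q.
have DE : p * s - q * r = p * D by rewrite /D; field.
have [_ D1] : p != 0 /\ D != 0.
  by apply/andP; rewrite -negb_or -mulf_eq0 -DE.
pose phi1 (u : T) : T := r / p * u + (d - r / p * c).
pose phi2 (u : T) : T := q * u + c.
have m1 : measurable_fun setT phi1 by exact: measurable_affine.
have m2 : measurable_fun setT phi2 by exact: measurable_affine.
pose F1 (x : T * T) : T * T := (x.1, D * x.2 + phi1 x.1).
pose F2 (x : T * T) : T * T := (x.1, p * x.2 + phi2 x.1).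
have mF1 : measurable (F1 @^-1` A).
  by rewrite -[X in measurable X]setTI; exact: measurable_fiber_affine.
have msF1 : measurable (swap2 @^-1` (F1 @^-1` A)).
  by rewrite -[X in measurable X]setTI; exact: measurable_swap2.
have mF2 : measurable (F2 @^-1` (swap2 @^-1` (F1 @^-1` A))).
  by rewrite -[X in measurable X]setTI; exact: measurable_fiber_affine.
rewrite DE normrM invfM EFinM -muleA -(mu2_fiber_affine D1 m1 mA).
rewrite -[X in _ = (_ * X)%E]/(mu2 (F1 @^-1` A)) -(mu2_swap mF1).
rewrite -(mu2_fiber_affine p0 m2 msF1).
rewrite -[RHS]/(mu2 (F2 @^-1` (swap2 @^-1` (F1 @^-1` A)))) -(mu2_swap mF2).
congr (mu2 _); apply/funext => x; congr (A _).
rewrite /F1 /F2 /swap2 /affine2 /phi1 /phi2 /= /D.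
by congr pair; field.
Qed.

(** The side on the second axis is left out so that the triangles of a fan
    around a common vertex, which share such sides, become disjoint. *)
Definition std_triangle : set (T * T) :=
  [set x | 0 < x.1 /\ 0 <= x.2 /\ x.1 + x.2 <= 1].

Lemma measurable_std_triangle : measurable std_triangle.
Proof.
have msum : measurable_fun setT (fun x : T * T => (x.1 + x.2 : R) : T).
  exact: measurable_funD.
rewrite [X in measurable X](_ : _ = fst @^-1` `]0, +oo[ `&`
  (snd @^-1` `[0, +oo[ `&` (fun x : T * T => x.1 + x.2 : R) @^-1` `]-oo, 1])).
  apply: measurableI; last apply: measurableI.
  - rewrite -[X in measurable X]setTI; 
    exact: (@measurable_fst _ _ T T measurableT _ (measurable_itv _)).
  - rewrite -[X in measurable X]setTI; 
    exact: (@measurable_snd _ _ T T measurableT _ (measurable_itv _)).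
  - by rewrite -[X in measurable X]setTI; exact: msum.
by apply/seteqP; split => x /=; rewrite !in_itv /= !andbT.
Qed.

Lemma mu2_std_triangle : mu2 std_triangle = (2^-1)%:E.
Proof.
rewrite /product_measure1.
have := @Rintegral_onemXn R 1; rewrite /Rintegral.
set I := (\int[mu]_(x in `[0%R, 1%R]) _)%E => fineI.
have <- : I = (2^-1)%:E.
  case: I fineI => [r /= -> //||] /= /esym/eqP;
  by rewrite invr_eq0 pnatr_eq0.
rewrite /I -integral_itv_obnd_cbnd; last first.
  apply/measurable_EFinP; apply: measurable_funS measurableT _ _ => //.
  under eq_fun do rewrite expr1.
  exact: measurable_funB.
rewrite [RHS]integral_mkcond; apply: eq_integral => x _ /=.
rewrite patchE; case: ifPn => x01.
  move: x01; rewrite inE /= in_itv /= => /andP[x0 x1].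
  rewrite [X in mu X](_ : _ = `[0, 1 - x]%classic).
    rewrite lebesgue_measure_itv /= lte_fin subr_gt0 expr1 /unstable.onem.
    rewrite -EFinB subr0.
    case: ltP => // x1'.
    by have -> : x = 1; [apply/eqP; rewrite eq_le x1|rewrite subrr].
  apply/seteqP; split => y; rewrite /xsection /= inE /std_triangle /= in_itv /=.
    by move=> [_ [-> yx]]; rewrite lerBrDl.
  by move=> /andP[y0]; rewrite lerBrDl.
rewrite [X in mu X](_ : _ = set0) ?measure0//.
apply/seteqP; split => // y; rewrite /xsection /= inE /std_triangle /=.
move=> [x0 [y0 xy]]; case/negP: x01.
by rewrite inE /= in_itv /= x0 (le_trans _ xy)// lerDl.
Qed.

End PlaneMeasure.

(** * Triangles of a fan *)

Section FanTriangle.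
Variables (R : realType) (V : normedModType R) (e1 e2 : V).
Hypothesis he : is_basis2 e1 e2.
Local Notation "''w'" := (det e1 e2).
Local Notation T := (measurableTypeR R).

(** The triangle [c, c + a, c + b], in the barycentric coordinates of Cramer's
    rule: a copy of the half-open standard triangle, without the vertex [c] and
    the side towards [c + b]. *)
Definition fan_triangle (c a b : V) : set V :=
  [set x | std_triangle ('w (x - c) b / 'w a b, 'w a (x - c) / 'w a b)].

Lemma fan_triangleE c a b (W := 'w a b) (A := coords e1 e2 a)
    (B := coords e1 e2 b) :
  lin_comb2 e1 e2 @^-1` fan_triangle c a b =
  affine2 (B.2 / W) (- B.1 / W) (- 'w c b / W)
          (- A.2 / W) (A.1 / W) (- 'w a c / W) @^-1` (@std_triangle R).
Proof.
apply/funext => x; rewrite /fan_triangle /preimage /=; congr std_triangle.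
rewrite /affine2 -/W (detBl he) (detBr he).
have -> : 'w (lin_comb2 e1 e2 x) b = x.1 * B.2 - x.2 * B.1.
  by rewrite /det (lin_comb2K he).
have -> : 'w a (lin_comb2 e1 e2 x) = A.1 * x.2 - A.2 * x.1.
  by rewrite /det (lin_comb2K he).
by congr pair; ring.
Qed.

Lemma measurable_fan_triangle c a b :
  measurable (lin_comb2 e1 e2 @^-1` fan_triangle c a b : set (T * T)).
Proof.
rewrite fan_triangleE -[X in measurable X]setTI.
by apply: measurable_affine2 => //; exact: measurable_std_triangle.
Qed.

Lemma area_fan_triangle c a b : 'w a b != 0 ->
  area e1 e2 (fan_triangle c a b) = (`|'w a b| / 2)%:E.
Proof.
move=> W0; rewrite /area fan_triangleE.
set A := coords e1 e2 a; set B := coords e1 e2 b.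
have dE : B.2 / 'w a b * (A.1 / 'w a b) - - B.1 / 'w a b * (- A.2 / 'w a b) =
    ('w a b)^-1.
  transitivity ((A.1 * B.2 - A.2 * B.1) / 'w a b / 'w a b); first by ring.
  by rewrite -[A.1 * _ - _]/('w a b) mulfV// mul1r.
rewrite mu2_affine2; last exact: measurable_std_triangle.
  by rewrite dE mu2_std_triangle normfV invrK.
by rewrite dE invr_eq0.
Qed.

(** Polar description: [a + theta *: (b - a)] runs through the outer side, whose
    end [b] is excluded, and [sigma] through the ray from [c]. *)
Lemma fan_triangleP c a b x : 'w a b != 0 ->
  fan_triangle c a b x <-> exists theta sigma : R,
    [/\ 0 <= theta, theta < 1, 0 < sigma, sigma <= 1
      & x - c = sigma *: (a + theta *: (b - a))].
Proof.
move=> W0; rewrite /fan_triangle /std_triangle /=.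
set s := 'w (x - c) b / _; set t := 'w a (x - c) / _.
have xc : x - c = s *: a + t *: b by exact: cramer_div.
split=> [[s0 [t0 st1]]|[th [sg [th0 th1 sg0 sg1 xE]]]].
  have st0 : 0 < s + t by rewrite ltr_wpDr.
  exists (t / (s + t)), (s + t); split => //.
  - by rewrite divr_ge0// ltW.
  - by rewrite ltr_pdivrMr// mul1r ltrDr.
  - rewrite scalerDr scalerA [_ * (_ / _)]mulrC divfK ?gt_eqF//.
    by rewrite scalerBr addrA addrAC -scalerBl addrK.
have -> : s = sg * (1 - th).
  by rewrite /s xE !(det_lin he); field.
have -> : t = sg * th.
  by rewrite /t xE !(det_lin he); field.
by split; [nra|split; nra].
Qed.

Lemma preimage_lin_comb2_set1 c : lin_comb2 e1 e2 @^-1` [set c] =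
  [set (coords e1 e2 c).1] `*` [set (coords e1 e2 c).2].
Proof.
apply/seteqP; split => [[x y] /= <-|[x y] /= [-> ->]].
  by rewrite (lin_comb2K he).
by rewrite -surjective_pairing (coordsK he).
Qed.

Lemma area_set1 c : area e1 e2 [set c] = 0%E.
Proof.
rewrite /area preimage_lin_comb2_set1.
rewrite product_measure1E; [|exact: measurable_set1|exact: measurable_set1].
by rewrite [X in (X * _)%E]lebesgue_measure_set1 mul0e.
Qed.
End FanTriangle.

(** * Convex polygons *)

Section RegionLemmas.
Local Open Scope convex_scope.
Variables (R : realType) (V : normedModType R).

Lemma region_vertex n (v : 'I_n -> V) i : region v (v i).
Proof. by apply: sub_gen_smallest; exists i. Qed.

Lemma convex_setP (A : set V) : @convex_set R V A <->
  forall x y (t : R), A x -> A y -> 0 <= t -> t <= 1 -> A (x + t *: (y - x)).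
Proof.
have E x y (t : R) : x + t *: (y - x) = t *: y + (1 - t) *: x.
  by rewrite scalerBr scalerBl scale1r addrCA.
split=> [cA x y t Ax Ay t0 t1|cA x y k xA yA].
  have := cA y x (Itv01 t0 t1) (mem_set Ay) (mem_set Ax).
  by rewrite inE E.
rewrite inE -[_ <| _ |> _]/(k%:num *: (x : V) + (1 - k%:num) *: (y : V)) -E.
by apply: cA; [exact: set_mem|exact: set_mem| |].
Qed.

Lemma region_conv n (v : 'I_n -> V) x y (t : R) :
  region v x -> region v y -> 0 <= t -> t <= 1 -> region v (x + t *: (y - x)).
Proof.
move=> vx vy t0 t1 A HA; have [/convex_setP cA _] := HA.
by apply: cA => //; [exact: vx|exact: vy].
Qed.

Lemma region_conv3 n (v : 'I_n -> V) x y z (s t : R) :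
  region v x -> region v y -> region v z -> 0 <= s -> 0 <= t -> s + t <= 1 ->
  region v (z + (s *: (x - z) + t *: (y - z))).
Proof.
move=> vx vy vz s0 t0 st1.
have [st|st] := eqVneq (s + t) 0.
  have -> : s = 0 by lra.
  have -> : t = 0 by lra.
  by rewrite !scale0r !addr0.
have st0 : 0 < s + t by rewrite lt_neqAle eq_sym st addr_ge0.
rewrite (_ : _ + t *: _ = (s + t) *: (y + (s / (s + t)) *: (x - y) - z)).
  apply: region_conv => //; last exact: ltW.
  apply: region_conv => //; first by rewrite divr_ge0// ltW.
  by rewrite ler_pdivrMr// mul1r lerDl.
rewrite [y + _ - z]addrAC (_ : x - y = (x - z) - (y - z)); last first.
  by rewrite opprB addrA subrK.
rewrite [RHS]scalerDr scalerA [_ * (_ / _)]mulrC divfK// (scalerBr s (x - z)).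
by rewrite [RHS]addrCA -[X in _ = _ + X]scalerBl [_ + t - s]addrAC subrr add0r.
Qed.

Lemma scalar_interp (f : {scalar V}) x y (t : R) :
  f (x + t *: (y - x)) = f x + t * (f y - f x).
Proof. by rewrite linearD linearZ linearB. Qed.

Lemma region_le n (v : 'I_n -> V) (f : {scalar V}) a :
  (forall i, f (v i) <= a) -> forall x, region v x -> f x <= a.
Proof.
move=> fv; apply: smallest_sub; last by move=> _ [i _ <-]; exact: fv.
apply/convex_setP => x y t /= fx fy t0 t1; rewrite scalar_interp; nra.
Qed.

(** The form takes a larger value than at [c] at one of the two ends of a
    diameter of the ball. *)
Lemma ball_scalar_lt (f : {scalar V}) (c : V) (rho a : R) :
  (exists x, f x != 0) -> 0 < rho ->
  (forall x, closed_ball_ Num.norm c rho x -> f x <= a) -> f c < a.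
Proof.
move=> [x fx] r0 H.
have x0 : 0 < `|x|.
  by rewrite normr_gt0; apply: contraNneq fx => ->; rewrite linear0.
(* The end of the diameter of direction [x] on which [f] is larger. *)
pose k := Num.sg (f x) * (rho / `|x|).
have : f (c + k *: x) <= a.
  apply: H; rewrite /closed_ball_ /= opprD addrA subrr add0r normrN normrZ.
  rewrite normrM normr_sg fx mul1r ger0_norm ?divfK ?gt_eqF//.
  by rewrite divr_ge0// ltW.
apply: lt_le_trans; rewrite linearD linearZ /= ltrDl.
by rewrite mulrAC -normrEsg mulr_gt0 ?normr_gt0// divr_gt0.
Qed.

End RegionLemmas.

(** Going around the cycle from [l], one reaches [k]. *)
Lemma cyclic_entry n (P : pred 'I_n) k l : P k -> ~~ P l ->
  exists i, ~~ P i /\ P (ordS i).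
Proof.
move=> Pk Pl; apply: contrapT => H.
have step i : ~~ P i -> ~~ P (ordS i).
  by move=> Pi; apply/negP => PS; apply: H; exists i.
have Piter m : ~~ P (iter m (@ordS n) l) by elim: m => //= m; exact: step.
have itv m : val (iter m (@ordS n) l) = ((l + m) %% n)%N.
  elim: m => [|m /= ->] /=; first by rewrite addn0 modn_small.
  by rewrite -[((l + m) %% n).+1%N]addn1 modnDml addn1 addnS.
move: (Piter (n - l + k)%N); rewrite (_ : iter _ _ _ = k) ?Pk//.
apply: val_inj; rewrite itv addnA subnKC; last exact: ltnW.
by rewrite modnDl modn_small.
Qed.

Lemma polygon_vertex_neqS (R : realType) (V : normedModType R) n
    (v : 'I_n -> V) i :
  convex_polygon v -> v i != v (ordS i).
Proof.
move=> [n3 tv _]; apply/eqP => E; have /(congr1 val) /= : i = ordS i.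
  have start k : half_open_segment (v k) (v (ordS k)) (v k).
    by exists 0; [rewrite /= in_itv /= lexx ltr01|rewrite scale0r addr0].
  apply: tv => //; exists (v i); split; first exact: start.
  by rewrite E; exact: start.
have [iS|iS] := ltnP i.+1 n; first by rewrite modn_small// => /n_Sn.
have iS' : i.+1 = n by apply/eqP; rewrite eqn_leq ltn_ord.
by rewrite iS' modnn => i0; move: n3; rewrite -iS' i0.
Qed.

(** * The area of a circumscribed polygon *)

Section Polygon.
Variables (R : realType) (V : normedModType R) (e1 e2 : V).
Hypothesis he : is_basis2 e1 e2.
Local Notation "''w'" := (det e1 e2).
Local Notation h := (dual_norm e1 e2).
Local Notation T := (measurableTypeR R).
Variables (n : nat) (v : 'I_n -> V) (c : V) (rho : R).
Hypothesis cv : convex_polygon v.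
Hypothesis rho0 : 0 < rho.
Hypothesis circ : circumscribed v c rho.
(* Vertices seen from the centre of the ball. *)
Let u i := v i - c.
Let us i := u (ordS i).

(** The bound on the polygon given by the form of a side holds on the ball, so
    the form is larger on the side than at the centre. *)
Lemma polygon_side_form i : exists f : {scalar V},
  [/\ 0 < f (u i), f (us i) = f (u i)
    & forall x, region v x -> f (x - c) <= f (u i)].
Proof.
have [_ _ /(_ i)[f [f0 fS fle]]] := cv.
have rle : forall x, region v x -> f x <= f (v i).
  by apply: region_le => j; apply: fle; exists j.
exists f; split.
- rewrite linearB subr_gt0; apply: (ball_scalar_lt f0 rho0) => x bx.
  by apply: rle; apply: circ.1.
- by rewrite /us /u !linearB /= -fS.
- by move=> x /rle; rewrite !linearB /= lerD2r.
Qed.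

Lemma region_center : region v c.
Proof. by apply: circ.1; rewrite /closed_ball_ /= subrr normr0 ltW. Qed.

(** Otherwise the polygon, hence the ball, would lie in a half-plane bounded by a
    line through the centre. *)
Lemma polygon_pos x : x != 0 -> exists j, 0 < 'w x (u j).
Proof.
move=> x0; apply: contrapT => H.
have [f fE] := det_linear_form he x.
suff : f c < f c by rewrite ltxx.
apply: (@ball_scalar_lt _ _ f c rho) => //.
  by have [y] := det_nondeg he x0; rewrite detC oppr_eq0 -fE; exists y.
move=> y /(circ.1); apply: region_le => j; rewrite leNgt; apply/negP => fj.
by apply: H; exists j; rewrite (detBr he) -!fE subr_gt0.
Qed.

Lemma side_disjoint i j (t s : R) : 0 <= t -> t < 1 -> 0 <= s -> s < 1 ->
  u i + t *: (us i - u i) = u j + s *: (us j - u j) -> i = j.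
Proof.
move=> t0 t1 s0 s1 E; have [_ /(_ i j I I) H _] := cv; apply: H.
have uE k (r : R) :
    v k + r *: (v (ordS k) - v k) = (u k + r *: (us k - u k)) + c.
  rewrite /us /u (_ : v (ordS k) - c - (v k - c) = v (ordS k) - v k).
    by rewrite addrAC subrK.
  by rewrite opprB addrA subrK.
exists (v i + t *: (v (ordS i) - v i)); split.
  by exists t => //; rewrite /= in_itv /= t0.
by exists s; rewrite /= ?in_itv /= ?s0// !uE E.
Qed.

Lemma side_region i (t : R) : 0 <= t -> t < 1 ->
  region v (c + (u i + t *: (us i - u i))).
Proof.
move=> t0 t1.
rewrite (_ : c + _ = v i + t *: (v (ordS i) - v i)).
  apply: region_conv => //; last exact: ltW.
    exact: region_vertex.
  exact: region_vertex.
rewrite /us /u (_ : v (ordS i) - c - (v i - c) = v (ordS i) - v i).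
  by rewrite addrA [c + _]addrC subrK.
by rewrite opprB addrA subrK.
Qed.

(** The ends of a side lie on a line that misses the centre, and they are
    distinct. *)
Lemma side_det_neq0 i : 'w (u i) (us i) != 0.
Proof.
have [f [f0 fS _]] := polygon_side_form i.
apply: contraTneq isT => /(det0_parallel he) [|l ul].
  by apply: contraTneq f0 => uS0; rewrite -fS uS0 linear0 ltxx.
have : u i != us i.
  by rewrite (inj_eq (addIr _)); exact: polygon_vertex_neqS.
rewrite ul.
have : f (u i) = l * f (u i) by rewrite {1}ul linearZ /= fS.
rewrite -{1}[f (u i)]mul1r => /mulIf; rewrite gt_eqF// => /(_ isT) <-.
by rewrite scale1r eqxx.
Qed.

(** A ray from the centre meets the boundary once. The form of either side is
    maximal there, which forces the scaling factors of two boundary points on one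
    ray to agree; so the points coincide, and the sides are disjoint. *)
Lemma side_ray i j (t s sg ta : R) :
  0 <= t -> t < 1 -> 0 <= s -> s < 1 -> 0 < sg -> 0 < ta ->
  sg *: (u i + t *: (us i - u i)) = ta *: (u j + s *: (us j - u j)) -> i = j.
Proof.
have le k l (r q a b : R) :
    0 <= r -> r < 1 -> 0 <= q -> q < 1 -> 0 < a -> 0 < b ->
    a *: (u k + r *: (us k - u k)) = b *: (u l + q *: (us l - u l)) -> a <= b.
  move=> r0 r1 q0 q1 a0 b0 E.
  have [f [f0 fS fle]] := polygon_side_form k.
  have := congr1 f E; rewrite !linearZ /=.
  have -> : f (u k + r *: (us k - u k)) = f (u k).
    by rewrite scalar_interp fS subrr mulr0 addr0.
  have := fle _ (side_region l q0 q1); rewrite addrAC subrr add0r => fl fE.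
  by rewrite -(@ler_pM2r _ (f (u k)))// fE ler_pM2l.
move=> t0 t1 s0 s1 sg0 ta0 E.
have sgta : sg = ta.
  apply/eqP; rewrite eq_le (le _ _ _ _ _ _ _ _ _ _ _ _ E)//=.
  exact: (le _ _ _ _ _ _ _ _ _ _ _ _ (esym E)).
move: E; rewrite sgta => /scalerI; rewrite gt_eqF// => /(_ isT).
exact: side_disjoint.
Qed.

Let F i := fan_triangle e1 e2 c (u i) (us i).

Lemma fan_trivIset : trivIset [set: 'I_n] F.
Proof.
move=> i j _ _ [x [+ +]].
move=> /(fan_triangleP he _ _ (side_det_neq0 i)) [t [a [t0 t1 a0 _ xi]]].
move=> /(fan_triangleP he _ _ (side_det_neq0 j)) [s [b [s0 s1 b0 _ xj]]].
by apply: (side_ray t0 t1 s0 s1 a0 b0); rewrite -xi.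
Qed.

(** The strict inequality at the end of the side keeps the crossing point off
    that end, which belongs to the next half-open side. *)
Lemma side_crossing i y : y != 0 -> 'w y (u i) <= 0 -> 0 < 'w y (us i) ->
  exists t l : R, [/\ 0 <= t, t < 1, l != 0
    & u i + t *: (us i - u i) = l *: y].
Proof.
move=> y0 wi wS; pose D := 'w y (us i) - 'w y (u i).
have D0 : 0 < D by rewrite subr_gt0 (le_lt_trans wi).
pose t := - 'w y (u i) / D.
have t0 : 0 <= t by rewrite divr_ge0 ?oppr_ge0// ltW.
have t1 : t < 1 by rewrite ltr_pdivrMr// mul1r /D ltrDr.
have : 'w (u i + t *: (us i - u i)) y = 0.
  have tD : t * D = - 'w y (u i) by rewrite divfK// gt_eqF.
  by rewrite detC (detDr he) (detZr he) (detBr he (us i)) -/D tD subrr oppr0.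
move=> /(det0_parallel he y0) [l lE]; exists t, l; split => //.
have [f [f0 fS _]] := polygon_side_form i.
apply: contraTneq f0 => l0; move: (congr1 f lE).
rewrite l0 scale0r linear0 scalar_interp fS subrr mulr0 addr0 => ->.
by rewrite ltxx.
Qed.

Lemma crossing_fan i x (t l : R) : region v x -> 0 <= t -> t < 1 -> 0 < l ->
  u i + t *: (us i - u i) = l *: (x - c) -> F i x.
Proof.
move=> vx t0 t1 l0 E; apply/(fan_triangleP he _ _ (side_det_neq0 i)).
exists t, l^-1; split => //; rewrite ?invr_gt0//; last first.
  by rewrite E scalerA mulVf ?gt_eqF// scale1r.
have [f [f0 fS fle]] := polygon_side_form i.
move: (congr1 f E); rewrite scalar_interp fS subrr mulr0 addr0 linearZ /=.
move=> fE; rewrite invf_le1// -(@ler_pM2r _ (f (u i)))// mul1r {1}fE.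
by rewrite ler_pM2l// fle.
Qed.

(** For a point [x <> c] of the region, there are vertices strictly on either
    side of the line through [c] and [x], so the boundary crosses it in both
    directions, on different sides of the polygon. The two crossing
    points cannot both be on the ray opposite to [x], by [side_ray]; the side
    that meets the ray of [x] spans the triangle containing [x]. *)
Lemma region_fan : region v = [set c] `|` \bigcup_i F i.
Proof.
apply/seteqP; split => [x vx|x [->|[i _]]].
- have [->|xc] := eqVneq x c; [by left|right].
  have y0 : x - c != 0 by rewrite subr_eq0.
  have [k wk] := polygon_pos y0.
  have [l wl] : exists l, 0 < 'w (- (x - c)) (u l).
    by apply: polygon_pos; rewrite oppr_eq0.
  have [i [/= wi wSi]] : exists i,
      ~~ (0 < 'w (x - c) (u i)) /\ 0 < 'w (x - c) (us i).
    apply: (@cyclic_entry n (fun i => 0 < 'w (x - c) (u i)) k l) => //.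
    by rewrite -leNgt -oppr_ge0 -(detNl he) ltW.
  have [j [/= wj wSj]] : exists j,
      ~~ (0 < 'w (- (x - c)) (u j)) /\ 0 < 'w (- (x - c)) (us j).
    apply: (@cyclic_entry n (fun i => 0 < 'w (- (x - c)) (u i)) l k) => //.
    by rewrite -leNgt (detNl he) oppr_le0 ltW.
  have [t [a [t0 t1 a0 E]]] : exists t l : R, [/\ 0 <= t, t < 1, l != 0
      & u i + t *: (us i - u i) = l *: (x - c)].
    by apply: side_crossing => //; rewrite leNgt.
  have [s [b [s0 s1 b0 E']]] : exists t l : R, [/\ 0 <= t, t < 1, l != 0
      & u j + t *: (us j - u j) = l *: (- (x - c))].
    by apply: side_crossing => //; rewrite ?oppr_eq0// leNgt.
  have [al0|al0] := ltP 0 a.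
    by exists i => //; exact: (crossing_fan vx t0 t1 al0).
  have [be0|be0] := ltP b 0.
    exists j => //.
    apply: (crossing_fan vx s0 s1 (l := - b)); first by rewrite oppr_gt0.
    by rewrite E' scalerN scaleNr.
  have : i = j.
    apply: (@side_ray _ _ _ _ b (- a) t0 t1 s0 s1).
    - by rewrite lt_neqAle eq_sym b0.
    - by rewrite oppr_gt0 lt_neqAle a0.
    - by rewrite E E' !scalerA scalerN -scaleNr mulNr opprK mulrC.
  by move=> ij; move: wSj; rewrite -ij (detNl he) oppr_gt0 ltNge ltW.
- exact: region_center.
- move=> /(fan_triangleP he _ _ (side_det_neq0 i)) [t [a [t0 t1 a0 a1 xE]]].
  rewrite -(subrK c x) addrC xE.
  rewrite -[X in a *: X](addrK c) [X in X - c]addrC.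
  apply: region_conv => //.
  + exact: region_center.
  + exact: side_region.
  + exact: ltW.
Qed.

(** The point where the side line touches the ball gives one inequality, since
    all points of the line have the same [det] with the side vector [s]. For the
    other one, a form that supports the ball along the side line is proportional
    to [x |-> det x s], whose maximum over the ball around 0 is [rho * h s]. *)
Lemma side_det_dual_norm i :
  `|'w (u i) (us i)| = rho * h (v (ordS i) - v i).
Proof.
set s := v (ordS i) - v i.
have usE : us i = u i + s.
  by rewrite /us /u /s [RHS]addrC addrA subrK.
have WE : 'w (u i) (us i) = 'w (u i) s by rewrite usE (detDr he) detxx add0r.
have [[_ [[t _ <-] bx]] [f [f0 fS fle]]] := circ.2 i.
have fs : f s = 0 by rewrite /s linearB /= fS subrr.
rewrite WE; apply/eqP; rewrite eq_le; apply/andP; split.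
  have -> : 'w (u i) s = 'w (v i + t *: s - c) s.
    by rewrite addrAC (detDl he (u i)) (detZl he) detxx mulr0 addr0.
  rewrite (le_trans (det_le he _ _))// mulrC ler_wpM2r ?(dual_norm_ge0 he)//.
  by move: bx; rewrite /closed_ball_ /= distrC.
have [w w1 wE] := dual_norm_attained he s.
have fu0 : 0 < f (u i) by rewrite linearB subr_gt0; exact: ball_scalar_lt fle.
have bw (e : R) : `|e| = 1 -> e * (rho * f w) <= f (u i).
  move=> e1'; rewrite [X in _ <= X]linearB lerBrDl.
  rewrite -linearZ -linearZ -linearD /=.
  apply: fle; rewrite /closed_ball_ /= opprD addrA subrr add0r normrN.
  by rewrite !normrZ e1' w1 mul1r mulr1 gtr0_norm.
have fw : `|rho * f w| <= f (u i).
  rewrite ler_norml lerNl -mulN1r bw ?normrN1//=.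
  by have := bw 1; rewrite normr1 mul1r; apply.
rewrite -(@ler_pM2r _ (f (u i)))// -mulrA -wE.
have := cramer_scalar he f (u i) s w; rewrite fs mulr0 addr0 => <-.
by rewrite mulrCA (le_trans (ler_norm _))// normrM ler_wpM2l.
Qed.

Lemma area_region : area e1 e2 (region v) =
  (rho / 2 * \sum_(i < n) h (v (ordS i) - v i))%:E.
Proof.
have mF i : measurable (lin_comb2 e1 e2 @^-1` F i : set (T * T)).
  exact: measurable_fan_triangle.
have mc : measurable (lin_comb2 e1 e2 @^-1` [set c] : set (T * T)).
  rewrite (preimage_lin_comb2_set1 he).
  by apply: measurableX; exact: measurable_set1.
have unionE (G : 'I_n -> set (T * T)) :
    \bigcup_i G i = \big[setU/set0]_(i < n) G i.
  rewrite -bigcup_seq; apply/seteqP.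
  split => [x [i _ Gx]|x [i _ Gx]]; exists i => //.
  by rewrite /= mem_index_enum.
rewrite region_fan /area preimage_setU preimage_bigcup unionE measureU//=.
- rewrite [X in (X + _)%E](area_set1 he c) add0e.
  rewrite measure_bigsetU_ord//; last first.
    move=> i j _ _ [x [xi xj]]; apply: fan_trivIset => //.
    by exists (lin_comb2 e1 e2 x).
  rewrite (eq_bigr (fun i => (rho / 2 * h (v (ordS i) - v i))%:E)).
    by rewrite sumEFin mulr_sumr.
  move=> i _; have := area_fan_triangle he c (side_det_neq0 i).
  by rewrite side_det_dual_norm mulrAC; exact.
- by apply: bigsetU_measurable.
- rewrite -unionE; apply/seteqP; split => // x [/= xc [i _]].
  move=> /(fan_triangleP he _ _ (side_det_neq0 i)) [t [a [t0 t1 a0 a1]]].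
  rewrite xc subrr => /eqP; rewrite eq_sym scaler_eq0 gt_eqF//= => /eqP E.
  have [f [f0 fS _]] := polygon_side_form i.
  move: (congr1 f E); rewrite scalar_interp fS subrr mulr0 addr0 linear0 => fE.
  by move: f0; rewrite fE ltxx.
Qed.

End Polygon.

Lemma region_subset (R : realType) (V : normedModType R) n m (v : 'I_n -> V)
    (w : 'I_m -> V) :
  (forall i, region w (v i)) -> region v `<=` region w.
Proof.
move=> vw; apply: smallest_sub; last by move=> _ [i _ <-].
by apply/convex_setP => x y t vx vy t0 t1; exact: region_conv.
Qed.

(** * Circumscribed triangles with given sides *)

Lemma ord3_cases (i j : 'I_3) : [\/ j = i, j = ordS i | i = ordS j].
Proof.
by case: i => [[|[|[|]]] // ?]; case: j => [[|[|[|]]] // ?];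
  solve [apply: Or31; exact: val_inj|apply: Or32; exact: val_inj
        |apply: Or33; exact: val_inj].
Qed.

(** The vertices [v], the side vectors [s] and the radius [r] are constrained by
    the relations that make all three sides play the same role: [W] is twice the
    area, and [wv] says that each side line is tangent to the ball of radius [r]
    about 0, the triangle being traversed counterclockwise. *)
Section TriangleWithSides.
Variables (R : realType) (V : normedModType R) (e1 e2 : V).
Hypothesis he : is_basis2 e1 e2.
Local Notation "''w'" := (det e1 e2).
Local Notation h := (dual_norm e1 e2).
Variables (v s : 'I_3 -> V) (r W : R).
Hypothesis r0 : 0 < r.
Hypothesis W0 : 0 < W.
Hypothesis vS : forall i, v (ordS i) = v i + s i.
Hypothesis wS : forall i, 'w (s i) (s (ordS i)) = W.
Hypothesis wv : forall i, 'w (v i) (s i) = r * h (s i).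

Lemma det_formr y : exists f : {scalar V}, forall x, f x = 'w x y.
Proof.
have [f fE] := det_linear_form he (- y).
by exists f => x; rewrite fE (detNl he) detC opprK.
Qed.

Let s_neq0 i : s i != 0.
Proof. by apply: contraTneq W0 => si; rewrite -(wS i) si (det0l he) ltxx. Qed.

Let side_vec i : v (ordS i) - v i = s i.
Proof. by rewrite vS addrAC subrr add0r. Qed.

Let w_next i : 'w (v (ordS i)) (s i) = 'w (v i) (s i).
Proof. by rewrite vS (detDl he) detxx addr0. Qed.

Let w_prev i : 'w (v i) (s (ordS i)) = 'w (v (ordS i)) (s (ordS i)) - W.
Proof. by rewrite vS (detDl he) wS addrK. Qed.

Let S3 (i : 'I_3) : ordS (ordS (ordS i)) = i.
Proof. by case: i => [[|[|[|]]] // ?]; exact: val_inj. Qed.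

Let w_prev2 i : 'w (v (ordS (ordS i))) (s i) = 'w (v i) (s i) - W.
Proof. by rewrite -{2}(S3 i) w_prev S3. Qed.

Let w_le i j : 'w (v j) (s i) <= 'w (v i) (s i).
Proof.
have [->|->|iE] := ord3_cases i j; first by [].
  by rewrite w_next.
have -> : j = ordS (ordS i) by rewrite iE S3.
by rewrite w_prev2 gerBl ltW.
Qed.

Lemma triangle_convex : convex_polygon v.
Proof.
split=> //.
  have nxt i t t' : t < 1 -> v i + t *: (v (ordS i) - v i) =
      v (ordS i) + t' *: (v (ordS (ordS i)) - v (ordS i)) -> False.
    move=> t1 /(congr1 (fun x => 'w x (s (ordS i)))).
    rewrite !side_vec !(detDl he) !(detZl he) detxx mulr0 addr0 wS w_prev.
    by move: t1 W0; nra.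
  move=> i j _ _ [x [[t /= +] <- [t' /= +]]]; rewrite !in_itv /=.
  move=> /andP[_ t1] /andP[_ t1'] E.
  have [->//|ji|ij] := ord3_cases i j; exfalso.
    by move: E; rewrite ji => /esym; exact: nxt.
  by move: E; rewrite ij; exact: nxt.
move=> i; have [f fE] := det_formr (s i); exists f; split.
- have [x xs] := det_nondeg he (s_neq0 i); by exists x; rewrite fE.
- by rewrite !fE w_next.
- by move=> _ [j _ <-]; rewrite !fE.
Qed.

Lemma triangle_circumscribed : circumscribed v 0 r.
Proof.
have ball x i : closed_ball_ Num.norm 0 r x -> 'w x (s i) <= 'w (v i) (s i).
  rewrite /closed_ball_ /= sub0r normrN => xr.
  rewrite wv (le_trans (ler_norm _))// (le_trans (det_le he _ _))// mulrC.
  by rewrite ler_wpM2r// (dual_norm_ge0 he).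
split=> [x bx|i].
  pose i := @ord0 2; pose a := s i; pose b := s (ordS i).
  have s2 : s (ordS (ordS i)) = - (a + b).
    have := vS (ordS (ordS i)); rewrite S3 !vS -!addrA -[X in X = _]addr0.
    move=> /addrI/esym; rewrite addrA => /eqP.
    by rewrite addrC addr_eq0 => /eqP.
  have wab : 'w a (a + b) = W by rewrite (detDr he) detxx add0r wS.
  have y0 : 'w a (a + b) != 0 by rewrite wab gt_eqF.
  rewrite -(subrK (v i) x) addrC (cramer_div he (x - v i) y0) wab.
  rewrite -[X in _ + _ *: X](_ : v (ordS (ordS i)) - v i = a + b); last first.
    by rewrite !vS addrAC [v i + _ - _]addrAC subrr add0r.
  rewrite -[X in _ *: X + _](_ : v (ordS i) - v i = a); last first.
    by rewrite side_vec.
  have b0 := ball x i bx; have b1 := ball x (ordS i) bx.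
  have b2 := ball x (ordS (ordS i)) bx.
  have p1 := w_prev i; have p2 := w_next (ordS (ordS i)).
  rewrite S3 in p2.
  rewrite -/a in b0; rewrite -/b in b1 p1.
  rewrite s2 !(detNr he) !(detDr he) in b2 p2.
  apply: region_conv3; rewrite ?divr_ge0 ?(ltW W0)//; try exact: region_vertex.
  - by rewrite (detBl he) !(detDr he); lra.
  - by rewrite (detBr he) ![ 'w a _]detC; lra.
  - rewrite -mulrDl ler_pdivrMr// mul1r (detBl he) (detBr he) !(detDr he).
    rewrite ![ 'w a _]detC; lra.
have [f fE] := det_formr (s i).
split; last first.
  exists f; split; [|by rewrite !fE w_next|by move=> x bx; rewrite !fE ball].
  by have [x xs] := det_nondeg he (s_neq0 i); exists x; rewrite fE.
have [y y1 yE] := dual_norm_attained he (s i).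
exists (r *: y); split; last first.
  by rewrite /closed_ball_ /= sub0r normrN normrZ y1 mulr1 gtr0_norm.
have /(det0_parallel he (s_neq0 i)) [l lE] : 'w (r *: y - v i) (s i) = 0.
  by rewrite (detBl he) (detZl he) yE wv subrr.
by exists l => //; rewrite side_vec -lE addrC subrK.
Qed.

End TriangleWithSides.

(** The radius comes from cutting the triangle from the centre of its inscribed
    ball: [W = r * (h a + h b + h (a + b))]. Then [v0] solves the linear system
    stating that the first two side lines are tangent to the ball of radius [r]
    about 0, and the choice of [r] makes this true of the third one. *)
Lemma exists_circumscribed_triangle (R : realType) (V : normedModType R)
    (e1 e2 a b : V) : is_basis2 e1 e2 -> 0 < det e1 e2 a b ->
  exists (v : 'I_3 -> V) (c : V) (rho : R),
    [/\ convex_polygon v, 0 < rho, circumscribed v c rho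
      & forall i : 'I_3, v (ordS i) - v i = nth 0 [:: a; b; - (a + b)] i].
Proof.
move=> he; set W := det e1 e2 a b => W0.
pose h := dual_norm e1 e2.
have a0 : a != 0 by apply: contraTneq W0 => a0; rewrite /W a0 (det0l he) ltxx.
have hS : 0 < h a + h b + h (a + b).
  by rewrite !ltr_wpDr ?(dual_norm_ge0 he)// (dual_norm_gt0 he).
pose r := W / (h a + h b + h (a + b)).
have r0 : 0 < r by rewrite divr_gt0.
have rE : r * h a + r * h b + r * h (a + b) = W.
  by rewrite -!mulrDr divfK// gt_eqF.
pose v0 := ((r * h b - W) / W) *: a - (r * h a / W) *: b.
have v0a : det e1 e2 v0 a = r * h a.
  rewrite /v0 !(det_lin he) [det _ _ b a]detC -/W.
  by field; rewrite gt_eqF.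
have v0b : det e1 e2 v0 b = r * h b - W.
  rewrite /v0 !(det_lin he) -/W.
  by field; rewrite gt_eqF.
pose v (i : 'I_3) := nth 0 [:: v0; v0 + a; v0 + a + b] i.
pose s (i : 'I_3) := nth 0 [:: a; b; - (a + b)] i.
have vS i : v (ordS i) = v i + s i.
  case: i => [[|[|[|]]] // ?]; rewrite /v /s //=.
  by rewrite -[v0 + a + b]addrA addrK.
have wS i : det e1 e2 (s i) (s (ordS i)) = W.
  case: i => [[|[|[|]]] // ?]; rewrite /s //= !(det_lin he) [det _ _ b a]detC -/W.
    by ring.
  by ring.
have wv i : det e1 e2 (v i) (s i) = r * h (s i).
  case: i => [[|[|[|]]] // ?]; rewrite /v /s //=.
    by rewrite (detDl he) v0b subrK.
  rewrite -[X in h X]scaleN1r /h (dual_normZ he) normrN1 mul1r -/h.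
  rewrite -addrA (detNr he) (detDl he) detxx addr0 (detDr he) v0a v0b.
  by rewrite -rE; ring.
exists v, 0, r; split => //.
- exact: (triangle_convex he W0 vS wS).
- exact: (triangle_circumscribed he r0 W0 vS wS wv).
- by move=> i; rewrite vS addrAC subrr add0r.
Qed.

(** * Subdividing a side of a triangle *)

Section SubdividedSide.
Variables (R : realType) (V : normedModType R).
Variables (P : 'I_3 -> V) (k : nat).
Let p j := P (inord j).
(* Indexed by natural numbers so that index [k.+3] again denotes [p 0], which
   is how the cyclic successor closes up. *)
Let Q' j : V := match j with
  | 0%N => p 0 | 1%N => p 1
  | j'.+2 => p 2 + (j'%:R / k.+1%:R) *: (p 0 - p 2)
  end.

Definition subdivide_side (i : 'I_k.+3) : V := Q' i.

Let Q := subdivide_side.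
Let g (i : 'I_k.+3) : 'I_3 := inord (minn i 2).
Let D i := P (ordS (g i)) - P (g i).

Let p_val (i : 'I_3) : P i = p i.
Proof. by rewrite /p inord_val. Qed.

Let QS i : Q (ordS i) = Q' i.+1.
Proof.
rewrite /Q /subdivide_side /=; have [iS|] := ltnP i.+1 k.+3.
  by rewrite modn_small.
move=> kS; have -> : val i = k.+2 by apply/eqP; rewrite eqn_leq -ltnS ltn_ord.
by rewrite modnn /= divff ?pnatr_eq0// scale1r addrC subrK.
Qed.

Let gS (i : 'I_k.+3) : P (ordS (g i)) = p ((minn i 2).+1 %% 3).
Proof.
by rewrite p_val /= inordK// ltnS geq_minr.
Qed.

(** Each side of the subdivided triangle is the part of the side [g i] of the
    triangle between the parameters [al] and [al + be]. *)
Let side_sub i : exists al be : R, [/\ 0 <= al, 0 < be, al + be <= 1,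
  Q i = P (g i) + al *: D i /\ Q (ordS i) = P (g i) + (al + be) *: D i &
  (2 <= i)%N -> al = (i - 2)%:R / k.+1%:R /\ be = k.+1%:R^-1].
Proof.
have k0 : 0 < k.+1%:R :> R by rewrite ltr0n.
rewrite QS /D gS p_val /g inordK ?ltnS ?geq_minr//.
case: i => [[|[|j]] //= jk].
- exists 0, 1; split=> //; rewrite -[minn 0 2]/0%N /= scale0r addr0 add0r.
  by rewrite scale1r addrC subrK.
- exists 0, 1; split=> //; rewrite -[minn 1 2]/1%N /= scale0r addr0 add0r.
  by rewrite scale1r mul0r scale0r addr0 [p 1 + _]addrC subrK.
- have -> : minn j.+2 2 = 2 by apply/minn_idPr.
  exists (j%:R / k.+1%:R), k.+1%:R^-1; split => //.
  + by rewrite -[X in _ + X]mul1r -mulrDl natr1 ler_pdivrMr// mul1r ler_nat.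
  + by rewrite -[X in (_ / _ + X) *: _]mul1r -mulrDl natr1.
  + by rewrite !subSS subn0.
Qed.

Let side_scalar (f : {scalar V}) i : f (P (g i)) = f (P (ordS (g i))) ->
  f (Q i) = f (P (g i)) /\ f (Q (ordS i)) = f (P (g i)).
Proof.
move=> fS; have [al [be [_ _ _ [-> ->] _]]] := side_sub i.
by rewrite !scalar_interp fS subrr !mulr0 !addr0.
Qed.

Lemma subdivide_side_region : region Q = region P.
Proof.
apply/seteqP; split; apply: region_subset => i.
  have [al [be [al0 be0 ab1 [-> _] _]]] := side_sub i.
  apply: region_conv; [exact: region_vertex|exact: region_vertex|by []|].
  by rewrite (le_trans _ ab1)// lerDl ltW.
have -> : P i = Q (inord i).
  rewrite /Q /subdivide_side inordK; last by have := ltn_ord i; lia.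
  rewrite p_val; case: i => [[|[|[|]]] //= _].
  by rewrite mul0r scale0r addr0.
exact: region_vertex.
Qed.

Lemma subdivide_side_per : per Q = per P.
Proof.
rewrite /per; under eq_bigr do rewrite QS.
rewrite /Q /subdivide_side 2!big_ord_recl.
rewrite [RHS]big_ord_recl [in RHS]big_ord_recl.
rewrite big_ord1 !p_val /= mul0r scale0r addr0; congr (_ + (_ + _)).
rewrite (eq_bigr (fun=> `|p 0 - p 2| / k.+1%:R)).
  by rewrite sumr_const card_ord -[_ *+ _]mulr_natr divfK// pnatr_eq0.
move=> i _; rewrite /= !add0n /bump /= add1n opprD addrACA subrr add0r.
rewrite -scalerBl -mulrBl.
rewrite -natr1 [X in X / _]addrAC subrr add0r normrZ.
by rewrite ger0_norm ?divr_ge0// mul1r mulrC.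
Qed.

Hypothesis cP : convex_polygon P.

Lemma subdivide_side_convex : convex_polygon Q.
Proof.
have [_ tP sP] := cP; split=> //.
  move=> i j _ _ [x [[t /= + xi] [s /= + xj]]]; rewrite !in_itv /=.
  move=> /andP[t0 t1] /andP[s0 s1].
  have [al [be [al0 be0 ab1 [QiE QiS] Ei]]] := side_sub i.
  have [ga [de [ga0 de0 gd1 [QjE QjS] Ej]]] := side_sub j.
  have xiE : x = P (g i) + (al + t * be) *: D i.
    rewrite -xi QiE QiS [al + be]addrC scalerDl addrCA addrK scalerA.
    by rewrite -addrA -scalerDl.
  have xjE : x = P (g j) + (ga + s * de) *: D j.
    rewrite -xj QjE QjS [ga + de]addrC scalerDl addrCA addrK scalerA.
    by rewrite -addrA -scalerDl.
  have gij : g i = g j.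
    apply: (tP (g i) (g j)) => //; exists x; split.
      exists (al + t * be); rewrite ?xiE// /= in_itv /=.
      apply/andP; split; nra.
    exists (ga + s * de); rewrite ?xjE// /= in_itv /=.
    apply/andP; split; nra.
  move: (congr1 val gij); rewrite /g /= !inordK ?ltnS ?geq_minr// => mij.
  have [i2|i2] := ltnP i 2; first by apply: val_inj => /=; lia.
  (* Both sides are parts of the last side of the triangle: compare parameters. *)
  have j2 : (2 <= j)%N by lia.
  have [alE beE] := Ei i2; have [gaE deE] := Ej j2.
  have D0 : D i != 0 by rewrite subr_eq0 eq_sym polygon_vertex_neqS.
  have : (al + t * be - (ga + s * de)) *: D i = 0.
    apply/eqP; rewrite scalerBl subr_eq0; apply/eqP/(addrI (P (g i))).
    by rewrite -xiE xjE /D gij.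
  move=> /eqP; rewrite scaler_eq0 (negbTE D0) orbF alE beE gaE deE -!mulrDl.
  rewrite -mulrBl mulf_eq0 invr_eq0 pnatr_eq0 orbF subr_eq0 => /eqP E.
  have ij : ((i - 2)%:R < (j - 2)%:R + 1 :> R) by lra.
  have ji : ((j - 2)%:R < (i - 2)%:R + 1 :> R) by lra.
  move: ij ji; rewrite !natr1 !ltr_nat => ij ji.
  by apply: val_inj => /=; lia.
move=> i; have [f [f0 fS fle]] := sP (g i).
have [fQ fQS] := side_scalar fS.
exists f; split => //; first by rewrite fQ fQS.
move=> _ [j _ <-]; rewrite fQ.
apply: (@region_le _ _ _ P) => [l|]; first by apply: fle; exists l.
by rewrite -subdivide_side_region; exact: region_vertex.
Qed.

Lemma subdivide_side_circumscribed c rho :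
  circumscribed P c rho -> circumscribed Q c rho.
Proof.
move=> [bP sP]; split; first by rewrite subdivide_side_region.
move=> i; have [[x [[t _ xE] bx]] [f [f0 fS fle]]] := sP (g i).
have [fQ fQS] := side_scalar fS.
split; last first.
  by exists f; split => //; [rewrite fQ fQS|move=> y /fle; rewrite fQ].
have [al [be [al0 be0 ab1 [QE QSE] _]]] := side_sub i.
exists x; split => //; exists ((t - al) / be) => //.
rewrite QE QSE -xE [al + be]addrC scalerDl addrCA addrK scalerA divfK ?gt_eqF//.
by rewrite -addrA -scalerDl [al + _]addrC subrK.
Qed.

End SubdividedSide.

(** * The equivalences *)

Theorem corollary10 (R : realType) (V : normedModType R) (e1 e2 : V)
    (he : is_basis2 e1 e2) :
  [<-> radon V;
       exists2 gamma : R, 0 < gamma &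
         forall (n : nat) (P : 'I_n -> V) (c : V) (rho : R),
           convex_polygon P -> 0 < rho -> circumscribed P c rho ->
           (rho * per P)%:E = (gamma%:E * area e1 e2 (region P))%E;
       exists2 gamma : R, 0 < gamma &
         exists2 n : nat, (3 <= n)%N &
           forall (P : 'I_n -> V) (c : V) (rho : R),
             convex_polygon P -> 0 < rho -> circumscribed P c rho ->
             (rho * per P)%:E = (gamma%:E * area e1 e2 (region P))%E;
       exists2 gamma : R, 0 < gamma &
         forall (P : 'I_3 -> V) (c : V) (rho : R),
           convex_polygon P -> 0 < rho -> circumscribed P c rho ->
           (rho * per P)%:E = (gamma%:E * area e1 e2 (region P))%E].
Proof.
tfae.
- move=> /(radon_dual_norm he)[k k0 hk].
  exists (2 / k); first by rewrite divr_gt0.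
  move=> n P c rho cP rho0 circ.
  rewrite (area_region he cP rho0 circ) -EFinM; congr EFin.
  under eq_bigr do rewrite hk.
  rewrite -mulr_sumr -/(per P); field.
  by rewrite gt_eqF.
- by move=> [gamma g0 H]; exists gamma => //; exists 3; last exact: H.
- move=> [gamma g0 [[|[|[|k]]]//= _ H]]; exists gamma => // P c rho cP rho0 circ.
  rewrite -(subdivide_side_per P k) -(subdivide_side_region P k).
  apply: H rho0 _; first exact: subdivide_side_convex.
  exact: subdivide_side_circumscribed circ.
- move=> [gamma g0 H].
  have g2 : gamma / 2 != 0 by rewrite gt_eqF// divr_gt0.
  apply: (@radon_of_dual_norm _ _ _ _ he (gamma / 2)^-1) => y.
  rewrite (dual_norm_of_triangles he (m := gamma / 2)) ?mulKf// => a b ab.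
  have [v [c [rho [cvx rho0 circ vE]]]] := exists_circumscribed_triangle he ab.
  have := H v c rho cvx rho0 circ.
  rewrite (area_region he cvx rho0 circ) -EFinM => -[].
  have sumE (N : V -> R) : \sum_(i < 3) N (v (ordS i) - v i) =
      N a + N b + N (- (a + b)).
    by rewrite 2!big_ord_recl big_ord1 !vE /= addrA.
  rewrite /per !sumE normrN -[in dual_norm _ _ (- _)]scaleN1r.
  rewrite (dual_normZ he) normrN1 mul1r => E.
  apply: (mulfI (_ : rho != 0)); first by rewrite gt_eqF.
  by rewrite E; ring.
Qed.
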